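(* Let $A,B\in\mathbb{C}^{n\times n}$ with $\mathrm{ind}(A)=k>0$, $\mathrm{ind}(B)=s$ and $\mathrm{rk}(A^k)=\mathrm{rk}(B^s)$. Let $E_B=B^2B^{\odot}-A$ and $Z=A^{\pi}E_BA^{\odot}(I+E_BA^{\odot})^{-1}$. If $\|E_BA^{\odot}\|<\dfrac{1}{1+\sqrt{2\|A^{\pi}\|}}$, then the following hold: (i) $\rho(Z^*Z)<\frac12$; (ii) $\rho\big(BB^{\odot}(I-AA^{\odot})\big)=\rho\big(AA^{\odot}(I-BB^{\odot})\big)\le\dfrac{\rho(Z^*Z)}{1-\rho(Z^*Z)}$; (iii) $\big(\rho(B^{\pi}-A^{\pi})\big)^2=\rho\big(AA^{\odot}(I-BB^{\odot})\big)=\rho\big((B^{\pi}-A^{\pi})^2\big)<1$; (iv) $I-BB^{\odot}A^{\pi}$, $I-AA^{\odot}B^{\pi}$, $I-(B^{\pi}-A^{\pi})$ and $I-(B^{\pi}-A^{\pi})^2$ are nonsingular.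
   Context: $\|\cdot\|$ denotes the spectral norm, $\rho(\cdot)$ the spectral radius, $(\cdot)^*$ the conjugate transpose and $\mathrm{rk}$ the rank. The index $\mathrm{ind}(M)$ of a square matrix $M$ is the smallest nonnegative integer $m$ with $\mathrm{rk}(M^{m+1})=\mathrm{rk}(M^m)$ (with $M^0=I$), so $\mathrm{ind}(M)>0$ exactly when $M$ is singular. For $M\in\mathbb{C}^{n\times n}$ with $\mathrm{ind}(M)=m$, $M^{\odot}$ denotes the core-EP inverse of $M$: the unique $X\in\mathbb{C}^{n\times n}$ with $XM^{m+1}=M^m$, $MX^2=X$, $(MX)^*=MX$. Put $M^{\pi}:=I-MM^{\odot}$. The matrix $Z$ is well defined since the norm hypothesis gives $\|E_BA^{\odot}\|<1$. *)

(* Defs.v *)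
From HB Require Import structures.
From mathcomp Require Import all_boot all_order all_algebra.
From mathcomp Require Import complex.
From mathcomp Require Import classical_sets reals.

Set Implicit Arguments.
Unset Strict Implicit.
Unset Printing Implicit Defensive.

Import Order.TTheory GRing.Theory Num.Theory.
Local Open Scope ring_scope.
Local Open Scope complex_scope.
Local Open Scope sesquilinear_scope.

Section Index.
Variables (F : fieldType) (n : nat).
Implicit Type M : 'M[F]_n.

Lemma mxindex_subproof M : exists m, \rank (M ^+ m.+1) == \rank (M ^+ m).
Proof.
have [//|H] := boolp.pselect (exists m, \rank (M ^+ m.+1) == \rank (M ^+ m)).
have dec m : (\rank (M ^+ m.+1) < \rank (M ^+ m))%N.
  rewrite ltn_neqAle; apply/andP; split; first by apply/negP => h; case: H; exists m.
  by rewrite exprS mxrankM_maxr.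
have bound m : (m + \rank (M ^+ m) <= n)%N.
  elim: m => [|m IH]; first by rewrite rank_leq_row.
  by apply: leq_trans IH; rewrite addSn -addnS leq_add2l.
by have := bound n.+1; rewrite addSn => /(leq_ltn_trans (leq_addr _ _)); rewrite ltnn.
Qed.

Definition mxindex M : nat := ex_minn (mxindex_subproof M).

End Index.

Section Norms.
Variable R : realType.

Definition vnorm n (x : 'cV[R[i]]_n) : R :=
  Num.sqrt (\sum_(j < n) Normc.normc (x j 0) ^+ 2).

Definition spectral_norm n (M : 'M[R[i]]_n) : R :=
  sup [set vnorm (M *m x) | x in [set x | vnorm x <= 1]]%classic.

(* [eigenvalue] refers to row eigenvectors; the eigenvalues are the same. *)
Definition spectral_radius n (M : 'M[R[i]]_n) : R :=
  sup [set Normc.normc a | a in [set a | eigenvalue M a]]%classic.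

End Norms.

Section CoreEP.
Variables (R : realType) (n : nat).
Implicit Types M X : 'M[R[i]]_n.

Definition is_coreEP M X : Prop :=
  let m := mxindex M in
  [/\ X *m M ^+ m.+1 = M ^+ m, M *m X ^+ 2 = X & (M *m X) ^t* = M *m X].

Lemma gram_unit r (F : 'M[R[i]]_(n, r)) : row_full F -> F ^t* *m F \in unitmx.
Proof.
case/row_fullP => F' F'F.
have FsF' : F ^t* *m F' ^t* = 1%:M.
  by rewrite -map_mxM -trmx_mul F'F trmx1 map_mx1.
rewrite -row_free_unit -kermx_eq0; apply/rowV0P => u /sub_kermxP uFF.
have uF0 : u *m F ^t* = 0.
  have : (u *m F ^t* *m (u *m F ^t*) ^t*) 0 0 = 0.
    by rewrite trmx_mul map_mxM trmxCK mulmxA -(mulmxA u) uFF mul0mx mxE.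
  rewrite mxE => /eqP; rewrite psumr_eq0 => [/allP wE|j _]; last first.
    by rewrite !mxE mul_conjC_ge0.
  apply/rowP => j; have /wE := mem_index_enum j.
  have -> : ((u *m F ^t*) ^t*) j 0 = ((u *m F ^t*) 0 j)^*%R by rewrite 2!mxE.
  by rewrite mul_conjC_eq0 [RHS]mxE => /eqP.
by rewrite -(mulmx1 u) -FsF' mulmxA uF0 mul0mx.
Qed.

Lemma mxindexP M : \rank (M ^+ (mxindex M).+1) = \rank (M ^+ mxindex M).
Proof. by rewrite /mxindex; case: ex_minnP => m /eqP. Qed.

Lemma coreEP_exists M : exists X, is_coreEP M X.
Proof.
rewrite /is_coreEP; have := mxindexP M; move: (mxindex M) => m rkM /=.
have [F' F'F] : exists F', F' *m col_base (M ^+ m) = 1%:M.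
  exact/row_fullP/col_base_full.
have [G' GG'] : exists G', row_base (M ^+ m) *m G' = 1%:M.
  exact/row_freeP/row_base_free.
move: (mulmx_base (M ^+ m)) F' F'F G' GG' rkM.
move: (col_base _) (row_base _); move: (\rank (M ^+ m)) => r F G FG F' F'F G' GG' rkM.
pose C := G *m M *m G'.
have MF : M *m F = F *m C.
  rewrite /C !mulmxA FG -[M ^+ m *m M]/(M ^+ m * M) -exprSr exprS.
  by rewrite -[M * _]/(M *m _) -FG mulmxA -[RHS]mulmxA GG' mulmx1.
have MFG : M ^+ m.+1 = F *m C *m G by rewrite exprS -MF -mulmxA FG.
have uC : C \in unitmx.
  rewrite -row_free_unit -row_leq_rank -[leqLHS]rkM MFG.
  by rewrite (leq_trans (mxrankM_maxl _ _)) // mxrankM_maxr.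
move: C MF MFG uC => C MF MFG uC.
have uF : F ^t* *m F \in unitmx by apply/gram_unit/row_fullP; exists F'.
pose X := F *m invmx C *m invmx (F ^t* *m F) *m F ^t*.
have MX : M *m X = F *m invmx (F ^t* *m F) *m F ^t*.
  by rewrite /X !mulmxA MF mulmxK.
exists X; split.
- by rewrite MFG /X !mulmxA -(mulmxA _ (F ^t*) F) !mulmxKV.
- rewrite expr2 -[X * X]/(X *m X) mulmxA MX /X !mulmxA.
  by rewrite -(mulmxA _ (F ^t*) F) mulmxKV.
- rewrite MX !trmx_mul !map_mxM trmxCK mulmxA; congr (_ *m _ *m _).
  rewrite trmx_inv map_invmx; congr invmx.
  by rewrite trmx_mul map_mxM trmxCK.
Qed.

Lemma coreEP_unique M X Y : is_coreEP M X -> is_coreEP M Y -> X = Y.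
Proof.
rewrite /is_coreEP; move: (mxindex M) => m /= [XM MX HX] [YM MY HY].
have pow Z j : M *m Z ^+ 2 = Z -> Z = M ^+ j *m Z ^+ j.+1.
  move=> MZ; elim: j => [|j IH]; first by rewrite expr0 expr1 mul1mx.
  rewrite {1}IH (exprSr M) -[M ^+ j * M]/(M ^+ j *m M) -mulmxA; congr (_ *m _).
  by rewrite (exprD _ 2 j) -[Z ^+ 2 * _]/(Z ^+ 2 *m _) mulmxA MZ exprS.
have XMZ Z Z' : Z *m M ^+ m.+1 = M ^+ m -> M *m Z' ^+ 2 = Z' -> Z *m (M *m Z') = Z'.
  move=> ZM MZ'; rewrite {1}(pow Z' m MZ') (mulmxA M) -[M *m M ^+ m]/(M * M ^+ m).
  by rewrite -exprS mulmxA ZM -pow.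
have PQ : M *m X = M *m Y *m (M *m X) by rewrite -mulmxA XMZ.
have QP : M *m Y = M *m X *m (M *m Y) by rewrite -mulmxA XMZ.
have MXY : M *m X = M *m Y.
  by rewrite -HX PQ trmx_mul map_mxM HX HY -QP.
by rewrite -(XMZ X X) // MXY XMZ.
Qed.

(* The default value 0 is never used: see coreEP_exists and coreEP_unique. *)
Definition coreEP M : 'M[R[i]]_n := xget 0 [set X | is_coreEP M X]%classic.

Lemma coreEPP M : is_coreEP M (coreEP M).
Proof. by apply: xgetPex; have [X] := coreEP_exists M; exists X. Qed.

End CoreEP.

(* Main.v *)
Require Import Defs.
From mathcomp Require Import all_boot all_order all_algebra.
From mathcomp Require Import complex reals.
From mathcomp Require Import classical_sets ring lra.

Set Implicit Arguments.
Unset Strict Implicit.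

Import Order.TTheory GRing.Theory Num.Theory.
Local Open Scope ring_scope.
Local Open Scope complex_scope.
Local Open Scope sesquilinear_scope.

(** Write P = A Ac and Q = B Bc.  The defining equations of the core-EP inverse
make these the orthogonal projectors onto the ranges of A^k and B^s, two
subspaces of the same dimension, and every assertion is about this pair.

Put T = E_B Ac.  Then T P = T, and P + T = B Q Ac has its range inside that of Q,
because the range of Q is invariant under B.  Since I + T is invertible,
P + T = (I + T) P has the rank of P, hence its range is exactly the range of Q.
Multiplying on the right by (I + T)^-1 turns P + T into P + Z, where P Z = 0 and
Z P = Z: the range of Q is the graph over the range of P of the slope Z
([perturbed_range_graph]).  The orthogonal projector onto such a graph is
  Q = (P + Z) (I + Z^* Z)^-1 (P + Z)^*
([graph_projectorE]), and this gives the two compressions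
  P (I - Q) P = (I + Z^* Z)^-1 Z^* Z,
  (I - P) Q (I - P) = Z (I + Z^* Z)^-1 Z^*.
They have the same spectral radius r because X Y and Y X have the same nonzero
eigenvalues.  The spectral radii of P (I - Q) and of Q (I - P) are r for the same
reason, and (P - Q)^2 is the sum of the two compressions, whose products vanish,
so that its spectral radius is r as well ([spectral_radius_projector_pair]).

The eigenvalues of Z^* Z are nonnegative reals, and those of (I + Z^* Z)^-1 Z^* Z
are the l / (1 + l) with l among them; hence r <= rho(Z^* Z)
([spectral_radius_resolvent_gram]).  This is sharper than the stated
bound rho(Z^* Z) / (1 - rho(Z^* Z)).  Finally, with t the norm of T and a <= 1
that of I - P, one gets |Z x| <= a t / (1 - t) |x|; the assumption on t says
that t < 1 and 2 a t^2 < (1 - t)^2, whence rho(Z^* Z) < 1/2 ([graph_slope_bound]).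
For the invertibility statements, 1 exceeds the spectral radii of the matrices
subtracted from I; the case of P - Q follows from that of its square.
*)

(** * Euclidean norm and spectral norm *)

Section EuclideanNorm.
Variable R : realType.
Implicit Types n : nat.

Lemma normc_real (a : R[i]) : `|a| = (Normc.normc a)%:C.
Proof. by []. Qed.

Lemma normc_ge0 (a : R[i]) : 0 <= Normc.normc a.
Proof. by rewrite -ler0c -normc_real normr_ge0. Qed.

Lemma trmxC_mul m n p (M : 'M[R[i]]_(m, n)) (N : 'M[R[i]]_(n, p)) :
  (M *m N) ^t* = N ^t* *m M ^t*.
Proof. by rewrite trmx_mul map_mxM. Qed.

Lemma trmxC_add m n (M N : 'M[R[i]]_(m, n)) : (M + N) ^t* = M ^t* + N ^t*.
Proof. by rewrite linearD /= map_mxD. Qed.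

Lemma trmxC_sub m n (M N : 'M[R[i]]_(m, n)) : (M - N) ^t* = M ^t* - N ^t*.
Proof. by rewrite linearB /= map_mxB. Qed.

Lemma trmxC1 n : (1%:M : 'M[R[i]]_n) ^t* = 1%:M.
Proof. by rewrite trmx1 map_mx1. Qed.

Lemma vnorm_ge0 n (x : 'cV[R[i]]_n) : 0 <= vnorm x.
Proof. exact: sqrtr_ge0. Qed.

Lemma vnorm_sqr n (x : 'cV[R[i]]_n) : vnorm x ^+ 2 = \sum_(j < n) Normc.normc (x j 0) ^+ 2.
Proof. by rewrite sqr_sqrtr // sumr_ge0 // => j _; rewrite sqr_ge0. Qed.

Lemma vnorm_gram n (x : 'cV[R[i]]_n) : (vnorm x ^+ 2)%:C = (x ^t* *m x) 0 0.
Proof.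
rewrite vnorm_sqr mxE rmorph_sum /=; apply: eq_bigr => j _.
by rewrite !mxE rmorphXn /= -normc_real normCKC.
Qed.

Lemma vnorm_eq0 n (x : 'cV[R[i]]_n) : (vnorm x == 0) = (x == 0).
Proof.
apply/eqP/eqP => [x0|->]; last first.
  by rewrite /vnorm big1 ?sqrtr0 // => j _; rewrite mxE Normc.normc0 expr0n.
have /eqP := vnorm_sqr x; rewrite x0 expr0n eq_sym psumr_eq0; last first.
  by move=> j _; rewrite sqr_ge0.
move=> /allP xj; apply/matrixP => j i; rewrite !ord1 mxE.
by have := xj j (mem_index_enum j); rewrite sqrf_eq0 => /eqP/Normc.eq0_normc.
Qed.

(** The triangle inequality is inherited from the Hermitian dot product on row
vectors, applied to the transposes. *)
Lemma vnormD n (x y : 'cV[R[i]]_n) : vnorm (x + y) <= vnorm x + vnorm y.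
Proof.
have vnormE (u : 'cV[R[i]]_n) : (vnorm u)%:C = sqrtC (dotmx u^T u^T).
  rewrite dotmxE -[LHS]sqrCK ?ler0c ?vnorm_ge0 // -rmorphXn /= vnorm_gram !mxE.
  by congr sqrtC; apply: eq_bigr => j _; rewrite !mxE mulrC.
rewrite -lecR rmorphD /= !vnormE linearD /=.
by case: (triangle_lerif (@dotmx R[i] n) x^T y^T).
Qed.

Lemma vnormZ n a (x : 'cV[R[i]]_n) : vnorm (a *: x) = Normc.normc a * vnorm x.
Proof.
rewrite -[RHS]ger0_norm ?mulr_ge0 ?vnorm_ge0 ?normc_ge0 // -sqrtr_sqr exprMn vnorm_sqr.
rewrite mulr_sumr; congr Num.sqrt; apply: eq_bigr => j _.
by rewrite mxE Normc.normcM exprMn.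
Qed.

Lemma vnormN n (x : 'cV[R[i]]_n) : vnorm (- x) = vnorm x.
Proof.
rewrite -scaleN1r vnormZ; have -> : Normc.normc (- 1 : R[i]) = 1.
  by apply: complexI; rewrite -normc_real normrN1.
by rewrite mul1r.
Qed.

Lemma vnorm_sum n (I : finType) (F : I -> 'cV[R[i]]_n) :
  vnorm (\sum_i F i) <= \sum_i vnorm (F i).
Proof.
elim/big_ind2: _ => [|x a y b xa yb|//].
  by rewrite (eqP (_ : vnorm 0 == 0)) ?vnorm_eq0.
by rewrite (le_trans (vnormD _ _)) // lerD.
Qed.

Lemma normc_le_vnorm n (x : 'cV[R[i]]_n) j : Normc.normc (x j 0) <= vnorm x.
Proof.
rewrite -ler_sqr ?nnegrE ?vnorm_ge0 ?normc_ge0 // vnorm_sqr (bigD1 j) //=.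
by rewrite lerDl sumr_ge0 // => i _; rewrite sqr_ge0.
Qed.

(** The sum of the norms of the columns bounds M x on the unit ball.  This is what
makes the supremum in [spectral_norm] a genuine one. *)
Lemma spectral_norm_has_ubound n (M : 'M[R[i]]_n) :
  has_ubound [set vnorm (M *m x) | x in [set x | vnorm x <= 1]]%classic.
Proof.
exists (\sum_j vnorm (col j M)) => _ [x /= x1 <-].
have -> : M *m x = \sum_j x j 0 *: col j M.
  apply/matrixP => i k; rewrite mxE summxE; apply: eq_bigr => j _.
  by rewrite !mxE ord1 mulrC.
rewrite (le_trans (vnorm_sum _)) // ler_sum // => j _.
by rewrite vnormZ ler_piMl ?vnorm_ge0 // (le_trans (normc_le_vnorm x j)).
Qed.

Lemma vnorm_mulmx_le n (M : 'M[R[i]]_n) x : vnorm (M *m x) <= spectral_norm M * vnorm x.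
Proof.
have [->|x0] := eqVneq x 0.
  by rewrite mulmx0 (eqP (_ : vnorm 0 == 0)) ?vnorm_eq0 // mulr0.
have vx0 : 0 < vnorm x by rewrite lt_neqAle eq_sym vnorm_eq0 x0 vnorm_ge0.
have nV : Normc.normc ((vnorm x)%:C^-1) = (vnorm x)^-1.
  rewrite Normc.normcV; congr _^-1; apply: complexI.
  by rewrite -normc_real ger0_norm // ler0c vnorm_ge0.
rewrite -ler_pdivrMr // mulrC -nV -vnormZ scalemxAr.
apply: ub_le_sup; first exact: spectral_norm_has_ubound.
by exists ((vnorm x)%:C^-1 *: x) => //=; rewrite vnormZ nV mulVf ?gt_eqF.
Qed.

Lemma spectral_norm_le n (M : 'M[R[i]]_n) c :
  (forall x, vnorm (M *m x) <= c * vnorm x) -> 0 <= c -> spectral_norm M <= c.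
Proof.
move=> Mc c0; apply: ge_sup.
  exists (vnorm (M *m 0)), 0 => //=.
  by rewrite (eqP (_ : vnorm 0 == 0)) ?vnorm_eq0.
by move=> _ [x /= x1 <-]; rewrite (le_trans (Mc x)) // ler_piMr.
Qed.

Lemma spectral_norm_ge0 n (M : 'M[R[i]]_n) : 0 <= spectral_norm M.
Proof.
apply: (le_trans (vnorm_ge0 (M *m 0))); apply: ub_le_sup.
  exact: spectral_norm_has_ubound.
by exists 0 => //=; rewrite (eqP (_ : vnorm 0 == 0)) ?vnorm_eq0.
Qed.

(** A vector x killed by I + M satisfies |x| = |M x| <= |M| |x|, so x = 0. *)
Lemma unitmx_addl n (M : 'M[R[i]]_n) : spectral_norm M < 1 -> 1%:M + M \in unitmx.
Proof.
move=> M1; rewrite -unitmx_tr -row_free_unit -kermx_eq0; apply/rowV0P => u /sub_kermxP.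
move/(congr1 trmx); rewrite trmx_mul trmxK trmx0 mulmxDl mul1mx => /eqP.
rewrite addr_eq0 => /eqP Mu; apply/eqP; rewrite -trmx_eq0 -vnorm_eq0.
have := vnorm_mulmx_le M u^T; rewrite -[M *m _]opprK -Mu vnormN.
rewrite -subr_le0 -{1}[vnorm _]mul1r -mulrBl.
rewrite pmulr_rle0 ?subr_gt0 // => le0; apply/eqP/le_anti.
by rewrite le0 vnorm_ge0.
Qed.

(** Pythagoras: |x|^2 = |P x|^2 + |x - P x|^2. *)
Lemma orthogonal_projector_contracts n (P : 'M[R[i]]_n) x :
  P *m P = P -> P ^t* = P -> vnorm (P *m x) <= vnorm x.
Proof.
move=> PP Ph; rewrite -ler_sqr ?nnegrE ?vnorm_ge0 //.
suff -> : vnorm x ^+ 2 = vnorm (P *m x) ^+ 2 + vnorm ((1%:M - P) *m x) ^+ 2.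
  by rewrite lerDl sqr_ge0.
apply: complexI; rewrite rmorphD /= !vnorm_gram.
rewrite !trmxC_mul trmxC_sub trmxC1 Ph -!mulmxA.
rewrite [P *m (P *m x)]mulmxA PP [(1%:M - P) *m (_ *m x)]mulmxA.
rewrite [(1%:M - P) *m (1%:M - P)]mulmxBl mul1mx mulmxBr mulmx1 PP subrr subr0.
transitivity ((x ^t* *m (P *m x + (1%:M - P) *m x)) 0 0).
  by rewrite -mulmxDl addrC subrK mul1mx.
by rewrite mulmxDr mxE.
Qed.

End EuclideanNorm.

(** * Spectral radius *)

Section SpectralRadius.
Variables (R : realType) (n : nat).
Implicit Types (M N Z : 'M[R[i]]_n) (a b : R[i]).

Lemma eigenvalue_det M a : eigenvalue M a = (\det (a%:M - M) == 0).
Proof.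
apply/eigenvalueP/det0P => [[v va v0]|[v v0 va]]; exists v => //.
  by rewrite mulmxBr va mul_mx_scalar subrr.
by apply/eqP; rewrite -mul_mx_scalar eq_sym -subr_eq0 -mulmxBr va.
Qed.

(** There are finitely many eigenvalues, the roots of the characteristic
polynomial, so their moduli form a bounded set. *)
Lemma eigenvalue_le_radius M a : eigenvalue M a -> Normc.normc a <= spectral_radius M.
Proof.
move=> Ma; apply: ub_le_sup; last by exists a.
have [rs chE] := closed_field_poly_normal (char_poly M).
exists (\sum_(r <- rs) Normc.normc r) => _ [b /= Mb <-].
have brs : b \in rs.
  have := Mb; rewrite eigenvalue_root_char chE (monicP (char_poly_monic M)) scale1r.
  by rewrite root_prod_XsubC.
rewrite (big_rem b) //= lerDl; apply: sumr_ge0 => r _; exact: normc_ge0.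
Qed.

Lemma spectral_radius0 M : ~ (exists a, eigenvalue M a) -> spectral_radius M = 0.
Proof.
move=> noM; rewrite /spectral_radius (_ : (_ @` _)%classic = set0) ?sup0 //.
by rewrite -subset0 => x [a Ma _]; apply: noM; exists a.
Qed.

Lemma spectral_radius_ge0 M : 0 <= spectral_radius M.
Proof.
have [[a Ma]|noM] := boolp.pselect (exists a, eigenvalue M a).
  exact: le_trans (normc_ge0 a) (eigenvalue_le_radius Ma).
by rewrite spectral_radius0.
Qed.

(** The eigenvalue 0 can be left out of the test because c is nonnegative; this is
what allows the comparisons below to look at nonzero eigenvalues only. *)
Lemma spectral_radius_le M c : 0 <= c ->
  (forall a, a != 0 -> eigenvalue M a -> Normc.normc a <= c) -> spectral_radius M <= c.
Proof.
move=> c0 Mc; have [[a Ma]|noM] := boolp.pselect (exists a, eigenvalue M a); last first.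
  by rewrite spectral_radius0.
apply: ge_sup; first by exists (Normc.normc a), a.
move=> _ [b /= Mb <-]; have [->|b0] := eqVneq b 0; last exact: Mc.
by rewrite Normc.normc0.
Qed.

Lemma spectral_radius_sub M N :
  (forall a, a != 0 -> eigenvalue M a -> eigenvalue N a) ->
  spectral_radius M <= spectral_radius N.
Proof.
move=> MN; apply: spectral_radius_le (spectral_radius_ge0 N) _ => a a0 Ma.
exact/eigenvalue_le_radius/MN.
Qed.

Lemma unitmx_sub M : spectral_radius M < 1 -> 1%:M - M \in unitmx.
Proof.
move=> M1; rewrite unitmxE unitfE -eigenvalue_det; apply/negP.
by move/eigenvalue_le_radius; rewrite Normc.normc1 leNgt M1.
Qed.

(** I - M is a factor of I - M^2 = (I - M) (I + M). *)
Lemma unitmx_sub_of_sqr M : 1%:M - M ^+ 2 \in unitmx -> 1%:M - M \in unitmx.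
Proof.
have -> : 1%:M - M ^+ 2 = (1%:M - M) *m (1%:M + M).
  by rewrite mulmxDr !mulmxBl !mul1mx mulmx1 addrA subrK expr2.
by rewrite unitmx_mul => /andP[].
Qed.

(** If v M N = a v, then v M is an eigenvector of N M; it is nonzero since a is. *)
Lemma eigenvalue_mulC M N a : a != 0 -> eigenvalue (M *m N) a -> eigenvalue (N *m M) a.
Proof.
move=> a0 /eigenvalueP[v va v0]; apply/eigenvalueP; exists (v *m M).
  by rewrite mulmxA -(mulmxA v) va scalemxAl.
apply: contraNneq v0 => vM; have /eqP := va.
by rewrite mulmxA vM mul0mx eq_sym scaler_eq0 (negPf a0).
Qed.

Lemma spectral_radius_mulC M N : spectral_radius (M *m N) = spectral_radius (N *m M).
Proof. by apply/le_anti/andP; split; apply: spectral_radius_sub => a a0; apply: eigenvalue_mulC. Qed.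

(** Squares of eigenvalues are eigenvalues of the square; conversely, if c^2 is an
eigenvalue of M^2, the factorization c^2 - M^2 = (c - M) (c + M) shows that c or
- c is an eigenvalue of M. *)
Lemma spectral_radius_sqr M : spectral_radius (M ^+ 2) = spectral_radius M ^+ 2.
Proof.
have r0 := spectral_radius_ge0; apply/le_anti/andP; split.
  apply: spectral_radius_le => [|b _]; first by rewrite sqr_ge0.
  have bE : b = sqrtC b * sqrtC b by rewrite -expr2 sqrtCK.
  move: (sqrtC b) bE => c ->; rewrite eigenvalue_det.
  have -> : (c * c)%:M - M ^+ 2 = (c%:M - M) *m (c%:M + M).
    rewrite mulmxDr !mulmxBl -scalar_mxM mul_scalar_mx mul_mx_scalar.
    by rewrite addrA subrK expr2.
  rewrite det_mulmx mulf_eq0 => /orP[|].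
    rewrite -eigenvalue_det => /eigenvalue_le_radius cM.
    by rewrite Normc.normcM -expr2 ler_sqr ?nnegrE ?normc_ge0.
  have -> : c%:M + M = - ((- c)%:M - M) by rewrite opprB rmorphN opprK addrC.
  rewrite -scaleN1r detZ mulf_eq0 expf_eq0 oppr_eq0 oner_eq0 andbF /=.
  rewrite -eigenvalue_det => /eigenvalue_le_radius cM.
  by rewrite -mulrNN Normc.normcM -expr2 ler_sqr ?nnegrE ?normc_ge0.
rewrite -(sqr_sqrtr (r0 (M ^+ 2))) ler_sqr ?nnegrE ?sqrtr_ge0 //.
apply: spectral_radius_le; first exact: sqrtr_ge0.
move=> a _ /eigenvalueP[v va v0].
rewrite -[Normc.normc a]ger0_norm ?normc_ge0 // -sqrtr_sqr ler_wsqrtr // expr2 -Normc.normcM.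
apply/eigenvalue_le_radius/eigenvalueP; exists v => //.
by rewrite expr2 -[M * M]/(M *m M) mulmxA va -scalemxAl va scalerA.
Qed.

(** Let v (M + N) = a v with a nonzero.  Since N M = 0, multiplying by M shows that
v M, if nonzero, is an eigenvector of M for a; if v M = 0, then v N = a v.
Conversely an eigenvector of M for a nonzero a is killed by N. *)
Lemma spectral_radius_add_orthogonal M N : M *m N = 0 -> N *m M = 0 ->
  spectral_radius (M + N) = Num.max (spectral_radius M) (spectral_radius N).
Proof.
move=> MN NM; apply/le_anti/andP; split.
  apply: spectral_radius_le => [|a a0 /eigenvalueP[v va v0]].
    by rewrite le_max; apply/orP; left; exact: spectral_radius_ge0.
  have [vM0|vM0] := eqVneq (v *m M) 0.
    rewrite le_max; apply/orP; right; apply/eigenvalue_le_radius/eigenvalueP.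
    by exists v => //; rewrite -va mulmxDr vM0 add0r.
  rewrite le_max; apply/orP; left; apply/eigenvalue_le_radius/eigenvalueP.
  exists (v *m M) => //.
  by rewrite scalemxAl -va mulmxDr mulmxDl -!mulmxA NM mulmx0 addr0.
rewrite ge_max; apply/andP; split; apply: spectral_radius_sub => a a0 /eigenvalueP[v va v0];
  apply/eigenvalueP; exists v => //; rewrite mulmxDr va.
  have : a *: v *m N = 0 by rewrite -va -mulmxA MN mulmx0.
  by rewrite -scalemxAl => /eqP; rewrite scaler_eq0 (negPf a0) => /eqP ->; rewrite addr0.
have : a *: v *m M = 0 by rewrite -va -mulmxA NM mulmx0.
by rewrite -scalemxAl => /eqP; rewrite scaler_eq0 (negPf a0) => /eqP ->; rewrite add0r.
Qed.

(** The Rayleigh quotient: pair the row eigenvector v with x = v^*. *)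
Lemma eigenvalue_gram Z a : eigenvalue (Z ^t* *m Z) a ->
  exists x : 'cV[R[i]]_n, vnorm x != 0 /\ a * (vnorm x ^+ 2)%:C = (vnorm (Z *m x) ^+ 2)%:C.
Proof.
move=> /eigenvalueP[v va v0]; exists (v ^t*); split.
  rewrite vnorm_eq0; apply: contra v0 => /eqP v0.
  by rewrite -[v]trmxCK v0 trmx0 map_mx0.
by rewrite !vnorm_gram trmxC_mul trmxCK -!mulmxA (mulmxA _ Z) mulmxA va -scalemxAl [RHS]mxE.
Qed.

Lemma eigenvalue_gram_ge0 Z a : eigenvalue (Z ^t* *m Z) a -> 0 <= a.
Proof.
case/eigenvalue_gram => x [x0 ax]; have : 0 < (vnorm x ^+ 2)%:C.
  by rewrite ltcR lt_neqAle sqr_ge0 eq_sym sqrf_eq0 x0.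
by move=> /pmulr_lge0 <-; rewrite ax ler0c sqr_ge0.
Qed.

Lemma spectral_radius_gram_le Z c : 0 <= c ->
  (forall x, vnorm (Z *m x) ^+ 2 <= c * vnorm x ^+ 2) -> spectral_radius (Z ^t* *m Z) <= c.
Proof.
move=> c0 Zc; apply: spectral_radius_le => // a _ Za.
have a0 := eigenvalue_gram_ge0 Za; have [x [x0 ax]] := eigenvalue_gram Za.
rewrite -lecR -normc_real ger0_norm //.
have x2 : 0 < (vnorm x ^+ 2)%:C.
  by rewrite ltcR lt_neqAle sqr_ge0 eq_sym sqrf_eq0 x0.
by rewrite -(ler_pM2r x2) ax -rmorphM lecR.
Qed.

(** The eigenvalues of Z^* Z are nonnegative, so - 1 is not one of them. *)
Lemma gram_add1_unit Z : 1%:M + Z ^t* *m Z \in unitmx.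
Proof.
rewrite unitmxE unitfE -[_ + _]opprK -scaleN1r detZ mulf_eq0 expf_eq0 oppr_eq0 oner_eq0 andbF.
rewrite opprD -scalemx1 -scaleNr scalemx1 -eigenvalue_det.
by apply/negP => /eigenvalue_gram_ge0; rewrite lerNr oppr0 ler10.
Qed.

(** An eigenvalue a of (I + W)^-1 W, with W = Z^* Z, differs from 1 and comes from
the eigenvalue l = a / (1 - a) of W.  As l >= 0, the modulus of
a = l / (1 + l) is at most l. *)
Lemma spectral_radius_resolvent_gram Z :
  spectral_radius (invmx (1%:M + Z ^t* *m Z) *m (Z ^t* *m Z)) <=
  spectral_radius (Z ^t* *m Z).
Proof.
have Nu := gram_add1_unit Z.
apply: spectral_radius_le (spectral_radius_ge0 _) _ => a a0 /eigenvalueP[v va v0].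
have {}gram0 := @eigenvalue_gram_ge0 Z.
have r0 := @eigenvalue_le_radius (Z ^t* *m Z).
move: (Z ^t* *m Z) Nu va gram0 r0 => W Nu va gram0 r0.
have vW : (1 - a) *: (v *m W) = a *: v.
  have : v *m (invmx (1%:M + W) *m W) *m (1%:M + W) = a *: v *m (1%:M + W) by rewrite va.
  have -> : v *m (invmx (1%:M + W) *m W) *m (1%:M + W) = v *m W.
    have WC : W *m (1%:M + W) = (1%:M + W) *m W by rewrite mulmxDr mulmxDl mulmx1 mul1mx.
    by rewrite -!mulmxA WC mulKmx.
  by rewrite mulmxDr mulmx1 -scalemxAl scalerBl scale1r => {1}->; rewrite addrK.
have a1 : 1 - a != 0.
  apply/eqP => a1; move/eqP: vW; rewrite a1 scale0r eq_sym scaler_eq0.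
  by rewrite (negPf a0) (negPf v0).
pose l := a / (1 - a).
have Wl : eigenvalue W l.
  apply/eigenvalueP; exists v => //; rewrite /l mulrC -scalerA -vW scalerA mulVf //.
  by rewrite scale1r.
have l0 := gram0 l Wl.
have aE : a * (1 + l) = l by rewrite /l; field.
apply: le_trans (r0 l Wl); rewrite -lecR -!normc_real -[X in _ <= `|X|]aE normrM.
rewrite ler_peMr // ger0_norm ?addr_ge0 //; by rewrite lerDl.
Qed.

End SpectralRadius.

(** * Pairs of orthogonal projectors *)

Section Projectors.
Variables (R : realType) (n : nat).
Implicit Types P Q T Z : 'M[R[i]]_n.

(** P and Z map into orthogonal subspaces, so the Gram matrix of P + Z is
(I + Z^* Z) P.  Hence the right-hand side K fixes P + Z, and both K Q = Q and
Q K = K hold; as K and Q are Hermitian, they are equal. *)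
Lemma graph_projectorE P Q Z S :
  P *m P = P -> P ^t* = P -> Q ^t* = Q -> P *m Z = 0 -> Z *m P = Z ->
  Q *m (P + Z) = P + Z -> Q = (P + Z) *m S ->
  Q = (P + Z) *m invmx (1%:M + Z ^t* *m Z) *m (P + Z) ^t*.
Proof.
move=> PP Ph Qh PZ ZP QG QS.
have ZhP : Z ^t* *m P = 0 by rewrite -Ph -trmxC_mul PZ trmx0 map_mx0.
have Nu := gram_add1_unit Z; set N := 1%:M + _ in Nu *.
have GG : (P + Z) ^t* *m (P + Z) = N *m P.
  rewrite trmxC_add Ph mulmxDl !mulmxDr PP PZ ZhP addr0 add0r.
  by rewrite mulmxDl mul1mx -mulmxA ZP.
have GP : (P + Z) *m P = P + Z by rewrite mulmxDl PP ZP.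
have NhV : (invmx N) ^t* = invmx N.
  rewrite trmx_inv map_invmx; congr invmx.
  by rewrite trmxC_add trmxC1 trmxC_mul trmxCK.
set K := RHS; have Kh : K ^t* = K by rewrite !trmxC_mul trmxCK NhV mulmxA.
have KQ : K *m Q = Q.
  rewrite {1}QS mulmxA; have -> : K *m (P + Z) = P + Z; last by rewrite -QS.
  by rewrite /K -mulmxA GG mulmxA mulmxKV // GP.
have QK : Q *m K = K by rewrite /K !mulmxA QG.
by rewrite -{1}Qh -KQ trmxC_mul Qh Kh QK.
Qed.

(** By orthogonality P (P + Z) = P, so the compression of Q to the range of P is
(I + Z^* Z)^-1 P.  Subtracting it from P leaves the formula below. *)
Lemma compl_compression P Q Z :
  P *m P = P -> P ^t* = P -> P *m Z = 0 -> Z *m P = Z ->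
  Q = (P + Z) *m invmx (1%:M + Z ^t* *m Z) *m (P + Z) ^t* ->
  P *m (1%:M - Q) *m P = invmx (1%:M + Z ^t* *m Z) *m (Z ^t* *m Z).
Proof.
move=> PP Ph PZ ZP ->.
have Nu := gram_add1_unit Z; set N := 1%:M + _ in Nu *.
have PZh : P *m Z ^t* = Z ^t* by rewrite -{1}Ph -trmxC_mul ZP.
have PG : P *m (P + Z) = P by rewrite mulmxDr PP PZ addr0.
have GP : (P + Z) ^t* *m P = P by rewrite -{2}Ph -trmxC_mul PG Ph.
have NP : N *m P = P *m N.
  by rewrite mulmxDl mulmxDr mul1mx mulmx1 -mulmxA ZP mulmxA PZh.
have VP : invmx N *m P = P *m invmx N.
  by rewrite -[LHS](mulmxK Nu) -(mulmxA _ P) -NP mulKmx.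
rewrite mulmxBr mulmx1 mulmxBl PP !mulmxA PG -mulmxA GP.
rewrite -VP -(mulmxA (invmx N) P P) PP.
rewrite -{1}(mulKmx Nu P) -mulmxBr mulmxDl mul1mx addrC addKr.
by rewrite -(mulmxA _ Z P) ZP mulmxA.
Qed.

Lemma compression_compl P Q Z :
  P *m P = P -> P ^t* = P -> P *m Z = 0 ->
  Q = (P + Z) *m invmx (1%:M + Z ^t* *m Z) *m (P + Z) ^t* ->
  (1%:M - P) *m Q *m (1%:M - P) = Z *m (invmx (1%:M + Z ^t* *m Z) *m Z ^t*).
Proof.
move=> PP Ph PZ ->.
have PG : (1%:M - P) *m (P + Z) = Z.
  by rewrite mulmxBl mul1mx mulmxDr PP PZ addr0 addrC addKr.
have GP : (P + Z) ^t* *m (1%:M - P) = Z ^t*.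
  by rewrite -{2}PG trmxC_mul trmxC_sub trmxC1 Ph.
by rewrite !mulmxA PG -mulmxA GP.
Qed.

(** The two compressions expand to P - P Q P and Q - P Q - Q P + P Q P; the terms
P Q P cancel in their sum. *)
Lemma sqr_projector_diff P Q : P *m P = P -> Q *m Q = Q ->
  (P - Q) ^+ 2 = P *m (1%:M - Q) *m P + (1%:M - P) *m Q *m (1%:M - P).
Proof.
move=> PP QQ; rewrite expr2 -[LHS]/((P - Q) *m (P - Q)).
rewrite !(mulmxBl, mulmxBr) !mul1mx !mulmx1 PP QQ.
by rewrite [RHS]addrC; apply/matrixP => i j; rewrite !mxE; ring.
Qed.

(** P and I - P are idempotent, so cyclic permutation of the factors turns
P (I - Q) and Q (I - P) into the two compressions. *)
Lemma spectral_radius_projector_pair P Q Z :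
  P *m P = P -> P ^t* = P -> Q *m Q = Q -> P *m Z = 0 -> Z *m P = Z ->
  Q = (P + Z) *m invmx (1%:M + Z ^t* *m Z) *m (P + Z) ^t* ->
  let r := spectral_radius (invmx (1%:M + Z ^t* *m Z) *m (Z ^t* *m Z)) in
  [/\ spectral_radius (P *m (1%:M - Q)) = r,
      spectral_radius (Q *m (1%:M - P)) = r &
      spectral_radius ((P - Q) ^+ 2) = r].
Proof.
move=> PP Ph QQ PZ ZP QE r.
have P'P : (1%:M - P) *m P = 0 by rewrite mulmxBl mul1mx PP subrr.
have PP' : P *m (1%:M - P) = 0 by rewrite mulmxBr mulmx1 PP subrr.
have P'P' : (1%:M - P) *m (1%:M - P) = 1%:M - P by rewrite mulmxBr mulmx1 P'P subr0.
have r1 : spectral_radius (P *m (1%:M - Q) *m P) = r.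
  by rewrite (compl_compression PP Ph PZ ZP QE).
have r2 : spectral_radius ((1%:M - P) *m Q *m (1%:M - P)) = r.
  rewrite (compression_compl PP Ph PZ QE) spectral_radius_mulC -(mulmxA _ _ Z).
  exact: erefl.
(* From here on only these two equations matter, not the value of r. *)
clearbody r; split.
- by rewrite -{1}PP -mulmxA spectral_radius_mulC.
- by rewrite -{1}P'P' mulmxA spectral_radius_mulC mulmxA.
rewrite (sqr_projector_diff PP QQ) spectral_radius_add_orthogonal.
- by rewrite r1 r2 maxxx.
- by rewrite !mulmxA -(mulmxA _ P (_ - P)) PP' mulmx0 !mul0mx.
- by rewrite !mulmxA -(mulmxA _ (_ - P) P) P'P mulmx0 !mul0mx.
Qed.

(** P + T = (I + T) P has the rank of P, that is of Q, and its range lies in that of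
Q; so the ranges agree, and right multiplication by (I + T)^-1 preserves them.
The factor S witnesses that the range of Q lies in that of P + Z. *)
Lemma perturbed_range_graph P Q T :
  P *m P = P -> T *m P = T -> Q *m (P + T) = P + T -> \rank P = \rank Q ->
  1%:M + T \in unitmx ->
  let Z := (1%:M - P) *m T *m invmx (1%:M + T) in
  [/\ P *m Z = 0, Z *m P = Z, Q *m (P + Z) = P + Z & exists S, Q = (P + Z) *m S].
Proof.
move=> PP TP QPT rPQ uT Z.
have GE : P + Z = (P + T) *m invmx (1%:M + T).
  rewrite -{1}(mulmxK uT P) -mulmxDl; congr (_ *m _).
  by rewrite mulmxDr mulmx1 mulmxBl mul1mx -addrA [P *m T + _]addrC subrK.
have TPE : P + T = (1%:M + T) *m P by rewrite mulmxDl mul1mx TP.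
have WP' : invmx (1%:M + T) *m (1%:M - P) = 1%:M - P.
  rewrite -[RHS](mulKmx uT); congr (_ *m _).
  by rewrite mulmxDl mul1mx mulmxBr mulmx1 TP subrr addr0.
split.
- by rewrite !mulmxA mulmxBr mulmx1 PP subrr !mul0mx.
- apply/eqP; rewrite eq_sym -subr_eq0 -{1}[Z]mulmx1 -mulmxBr.
  by rewrite /Z -!mulmxA WP' mulmxBr mulmx1 TP subrr mulmx0.
- by rewrite GE mulmxA QPT.
(* Inclusions of column spaces are read on the transposes, as row spaces. *)
have sPT : ((P + T)^T <= Q^T)%MS by rewrite -{1}QPT trmx_mul submxMl.
have : (Q^T <= (P + T)^T)%MS.
  rewrite -(mxrank_leqif_sup sPT) !mxrank_tr -rPQ TPE eqmxMfull //.
  by rewrite row_full_unit.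
case/submxP => S QS; exists ((1%:M + T) *m S^T).
by rewrite GE mulmxA mulmxKV // -[Q]trmxK QS trmx_mul trmxK.
Qed.

(** With y = (I + T)^-1 x one has x = y + T y, hence (1 - t) |y| <= |x|, while
|Z x| = |(I - P) T y| <= a t |y|.  The assumption gives t q < 1 - t with
q^2 = 2 a, that is a t^2 < (1 - t)^2 / 2, and a <= 1 since I - P is an orthogonal
projector; so c = a t^2 / (1 - t)^2 is a valid constant below 1/2. *)
Lemma graph_slope_bound P T :
  P *m P = P -> P ^t* = P ->
  spectral_norm T < 1 / (1 + Num.sqrt (2 * spectral_norm (1%:M - P))) ->
  1%:M + T \in unitmx /\
  exists2 c, 0 <= c < 1 / 2 & forall x : 'cV[R[i]]_n,
    vnorm ((1%:M - P) *m T *m invmx (1%:M + T) *m x) ^+ 2 <= c * vnorm x ^+ 2.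
Proof.
move=> PP Ph.
have a1 : spectral_norm (1%:M - P) <= 1.
  apply: spectral_norm_le => // x; rewrite mul1r.
  apply: orthogonal_projector_contracts; last by rewrite trmxC_sub trmxC1 Ph.
  by rewrite mulmxBr mulmx1 mulmxBl mul1mx PP subrr subr0.
have Ple := vnorm_mulmx_le (1%:M - P); have Tle := vnorm_mulmx_le T.
have uT := @unitmx_addl _ _ T; have a0 := spectral_norm_ge0 (1%:M - P).
have t0 := spectral_norm_ge0 T.
move: (spectral_norm _) (spectral_norm _) t0 a0 a1 Ple Tle uT => a t t0 a0 a1 Ple Tle uT.
have q0 := sqrtr_ge0 (2 * a); have q2 : Num.sqrt (2 * a) ^+ 2 = 2 * a.
  by rewrite sqr_sqrtr // mulr_ge0.
move: (Num.sqrt _) q0 q2 => q q0 q2; rewrite ltr_pdivlMr; last by lra.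
move=> tq; have tq0 : 0 <= t * q by rewrite mulr_ge0.
have t1 : t < 1 by lra.
have {}uT := uT t1; split=> //.
have t1' : 0 < (1 - t) ^+ 2 by rewrite exprn_gt0 // subr_gt0.
have c0 : 0 <= a * t ^+ 2 / (1 - t) ^+ 2.
  by rewrite divr_ge0 ?(ltW t1') // mulr_ge0 ?sqr_ge0.
exists (a * t ^+ 2 / (1 - t) ^+ 2).
  rewrite c0 /=.
  rewrite ltr_pdivrMr //.
  have : (t * q) ^+ 2 < (1 - t) ^+ 2 by rewrite ltr_sqr ?nnegrE; lra.
  by rewrite exprMn q2; lra.
move=> x; rewrite -!mulmxA; set y := invmx _ *m x.
have xE : x = y + T *m y by rewrite -{1}(mulKVmx uT x) mulmxDl mul1mx.
have vy0 := vnorm_ge0 y; have vT0 := vnorm_ge0 (T *m y); have vx0 := vnorm_ge0 x.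
have yx : (1 - t) * vnorm y <= vnorm x.
  have := vnormD x (- (T *m y)); rewrite {1}xE addrK vnormN; have := Tle y; lra.
have Zy : vnorm ((1%:M - P) *m (T *m y)) <= a * (t * vnorm y).
  by apply: le_trans (Ple _) _; rewrite ler_wpM2l.
apply: (@le_trans _ _ ((a * (t * vnorm y)) ^+ 2)).
  by rewrite ler_sqr ?nnegrE ?vnorm_ge0 // !mulr_ge0.
apply: (@le_trans _ _ (a * t ^+ 2 / (1 - t) ^+ 2 * ((1 - t) * vnorm y) ^+ 2)).
  rewrite !exprMn [leRHS]mulrA divfK ?gt_eqF // -[leRHS]mulrA.
  rewrite ler_wpM2r ?(mulr_ge0 (sqr_ge0 _) (sqr_ge0 _)) //.
  by rewrite expr2 ler_piMl.
have y0 : 0 <= (1 - t) * vnorm y by rewrite mulr_ge0 // subr_ge0 ltW.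
by rewrite ler_wpM2l // ler_sqr ?nnegrE.
Qed.

End Projectors.

(** * The projector attached to a core-EP inverse *)

Section CoreEPProjector.
Variables (R : realType) (n : nat).
Variables M X : 'M[R[i]]_n.
Hypothesis MX : is_coreEP M X.

(** Iterate X = M X^2: this exhibits the columns of X in the range of every power
of M, where X acts as a left inverse of M. *)
Lemma coreEP_iter j : X = M ^+ j *m X ^+ j.+1.
Proof.
case: MX => _ MXX _; elim: j => [|j IH]; first by rewrite expr0 expr1 mul1mx.
rewrite {1}IH (exprSr M) -[M ^+ j * M]/(M ^+ j *m M) -mulmxA; congr (_ *m _).
by rewrite (exprD _ 2 j) -[X ^+ 2 * _]/(X ^+ 2 *m _) mulmxA MXX exprS.
Qed.

Lemma coreEP_outer : X *m M *m X = X.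
Proof.
case: MX => XM _ _; rewrite {2}(coreEP_iter (mxindex M)) mulmxA -(mulmxA X).
by rewrite -[M *m _]/(M * _) -exprS XM -coreEP_iter.
Qed.

Lemma coreEP_proj_idem : M *m X *m (M *m X) = M *m X.
Proof. by rewrite -mulmxA [X *m _]mulmxA coreEP_outer. Qed.

Lemma coreEP_proj_herm : (M *m X) ^t* = M *m X.
Proof. by case: MX. Qed.

Lemma coreEP_proj_power : M *m X *m M ^+ mxindex M = M ^+ mxindex M.
Proof.
case: MX => XM MXX _; rewrite -XM.
by rewrite mulmxA -(mulmxA M X X) -[X *m X]/(X * X) -expr2 MXX.
Qed.

Lemma coreEP_projE : M *m X = M ^+ mxindex M *m (M *m X ^+ (mxindex M).+1).
Proof.
rewrite {1}(coreEP_iter (mxindex M)) !mulmxA; congr (_ *m _).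
by rewrite -[LHS]/(M * _) -exprS exprSr.
Qed.

(** M X and M^m, with m the index of M, have the same range, each being the other one
times a matrix on the right. *)
Lemma coreEP_proj_rank : \rank (M *m X) = \rank (M ^+ mxindex M).
Proof.
apply/eqP; rewrite eqn_leq {1}coreEP_projE mxrankM_maxl /=.
by rewrite -{1}coreEP_proj_power mxrankM_maxl.
Qed.

(** M X projects onto the range of a power of M, which is stable under M. *)
Lemma coreEP_proj_invariant : M *m X *m (M *m (M *m X)) = M *m (M *m X).
Proof.
have -> : M *m (M *m X) = M ^+ mxindex M *m (M *m (M *m X ^+ (mxindex M).+1)).
  rewrite {1}coreEP_projE !mulmxA; congr (_ *m _ *m _).
  by rewrite -[LHS]/(M * _) -exprS exprSr.
by rewrite mulmxA coreEP_proj_power.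
Qed.

End CoreEPProjector.

(** The last step of the numerical estimates, from r <= t to the weaker t / (1 - t). *)
Lemma le_odds (F : realFieldType) (r t : F) :
  0 <= t -> t < 1 / 2 -> r <= t -> r < 1 /\ r <= t / (1 - t).
Proof.
move=> t0 t12 rt; split; first by lra.
by rewrite (le_trans rt) // ler_pdivlMr; nra.
Qed.

Theorem theorem4p2 (R : realType) (n k s : nat) (A B : 'M[R[i]]_n)
    (hk : mxindex A = k) (k_gt0 : (0 < k)%N) (hs : mxindex B = s)
    (hrk : \rank (A ^+ k) = \rank (B ^+ s)) :
  let Ac := coreEP A in
  let Bc := coreEP B in
  let Api := 1%:M - A *m Ac in
  let Bpi := 1%:M - B *m Bc in
  let EB := B ^+ 2 *m Bc - A in
  let Z := Api *m EB *m Ac *m invmx (1%:M + EB *m Ac) in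
  spectral_norm (EB *m Ac) < 1 / (1 + Num.sqrt (2 * spectral_norm Api)) ->
  [/\ (* (i) *)
      spectral_radius (Z ^t* *m Z) < 1 / 2,
      (* (ii) *)
      spectral_radius (B *m Bc *m (1%:M - A *m Ac))
        = spectral_radius (A *m Ac *m (1%:M - B *m Bc)) /\
      spectral_radius (A *m Ac *m (1%:M - B *m Bc))
        <= spectral_radius (Z ^t* *m Z) / (1 - spectral_radius (Z ^t* *m Z)),
      (* (iii) *)
      [/\ spectral_radius (Bpi - Api) ^+ 2
            = spectral_radius (A *m Ac *m (1%:M - B *m Bc)),
          spectral_radius (A *m Ac *m (1%:M - B *m Bc))
            = spectral_radius ((Bpi - Api) ^+ 2) &
          spectral_radius ((Bpi - Api) ^+ 2) < 1] &
      (* (iv) *)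
      [/\ 1%:M - B *m Bc *m Api \in unitmx,
          1%:M - A *m Ac *m Bpi \in unitmx,
          1%:M - (Bpi - Api) \in unitmx &
          1%:M - (Bpi - Api) ^+ 2 \in unitmx]].
Proof.
move=> Ac Bc Api Bpi EB Z hE.
have cA : is_coreEP A Ac := coreEPP A; have cB : is_coreEP B Bc := coreEPP B.
have PP := coreEP_proj_idem cA; have Ph := coreEP_proj_herm cA.
have QQ := coreEP_proj_idem cB; have Qh := coreEP_proj_herm cB.
have TP : EB *m Ac *m (A *m Ac) = EB *m Ac.
  by rewrite -mulmxA (mulmxA Ac) (coreEP_outer cA).
(* The term - A of E_B cancels A Ac, which leaves B^2 Bc Ac. *)
have PTE : A *m Ac + EB *m Ac = B *m (B *m Bc) *m Ac.
  by rewrite -mulmxDl addrC subrK expr2 !mulmxA.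
have QPT : B *m Bc *m (A *m Ac + EB *m Ac) = A *m Ac + EB *m Ac.
  by rewrite PTE mulmxA (coreEP_proj_invariant cB).
have rPQ : \rank (A *m Ac) = \rank (B *m Bc).
  by rewrite (coreEP_proj_rank cA) (coreEP_proj_rank cB) hk hs.
have [uT [c /andP[c0 c12] Zc]] := graph_slope_bound PP Ph hE.
have [] := perturbed_range_graph PP TP QPT rPQ uT.
have ZE : Z = Api *m (EB *m Ac) *m invmx (1%:M + EB *m Ac) by rewrite /Z -(mulmxA Api).
rewrite -ZE in Zc *; move=> PZ ZP QG [S QS].
have QE := graph_projectorE PP Ph Qh PZ ZP QG QS.
have [rP rQ rD] := spectral_radius_projector_pair PP Ph QQ PZ ZP QE.
have rle := spectral_radius_resolvent_gram Z.
have rZ0 := spectral_radius_ge0 (Z ^t* *m Z).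
have rZ : spectral_radius (Z ^t* *m Z) < 1 / 2.
  exact: le_lt_trans (spectral_radius_gram_le c0 Zc) c12.
have BA : Bpi - Api = A *m Ac - B *m Bc.
  by rewrite /Bpi /Api opprB addrC addrA subrK.
have [r1 rodds] := le_odds rZ0 rZ rle.
have {}rD := etrans (congr1 (fun M : 'M_n => spectral_radius (M ^+ 2)) BA) rD.
have rDD := etrans (esym (spectral_radius_sqr (Bpi - Api))) rD.
have uQ : 1%:M - B *m Bc *m Api \in unitmx by apply: unitmx_sub; rewrite rQ.
have uP : 1%:M - A *m Ac *m Bpi \in unitmx by apply: unitmx_sub; rewrite rP.
have uDD : 1%:M - (Bpi - Api) ^+ 2 \in unitmx by apply: unitmx_sub; rewrite rD.
have uD := unitmx_sub_of_sqr uDD.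
split.
- exact: rZ.
- split; first exact (etrans rQ (esym rP)).
  rewrite rP; exact rodds.
- split.
  + exact (etrans rDD (esym rP)).
  + exact (etrans rP (esym rD)).
  + rewrite rD; exact r1.
- split; [exact uQ | exact uP | exact uD | exact uDD].
Qed.
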